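(* Let $A\in\mathbb{C}^{n\times n}$ be a Hermitian matrix, and let the columns of the matrices $X,Y\in\mathbb{C}^{n\times p}$ form orthonormal bases of subspaces $\mathcal{X}$ and $\mathcal{Y}$ of $\mathbb{C}^n$, respectively, with $\dim(\mathcal{X})=\dim(\mathcal{Y})=p$. Assume $\Theta(\mathcal{X},\mathcal{Y})<\pi/2$ (all principal angles are less than $\pi/2$). Then $$\left|\Lambda(X^HAX)-\Lambda(Y^HAY)\right|\prec_w \frac{1}{\cos(\theta_{\max}(\mathcal{X},\mathcal{Y}))}\left\{S(P_{\mathcal{Y}}R_X)+S(P_{\mathcal{X}}R_Y)\right\}.$$ If the subspace $\mathcal{X}$ is $A$-invariant, then $$\left|\Lambda(X^HAX)-\Lambda(Y^HAY)\right|\prec_w \frac{1}{\cos(\theta_{\max}(\mathcal{X},\mathcal{Y}))}\,S(P_{\mathcal{X}}R_Y).$$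
   Context: $\Lambda(\cdot)$ is the vector of eigenvalues of a Hermitian matrix in decreasing order. $S(\cdot)$ is the vector of singular values of a matrix in decreasing order (for an $n\times p$ matrix with $p\le n$, it has $p$ entries). $R_X=AX-X(X^HAX)$ and $R_Y=AY-Y(Y^HAY)$ are the residual matrices. $P_{\mathcal{X}}$, $P_{\mathcal{Y}}$ are the orthogonal projectors onto $\mathcal{X}$, $\mathcal{Y}$. The principal angles between $\mathcal{X}$ and $\mathcal{Y}$ lie in $[0,\pi/2]$ and are the numbers whose cosines are the singular values of $X^HY$; $\Theta(\mathcal{X},\mathcal{Y})$ is the vector of these angles in decreasing order, and $\theta_{\max}(\mathcal{X},\mathcal{Y})$ is the largest of them. A subspace $\mathcal{X}$ is $A$-invariant if $A\mathcal{X}\subset\mathcal{X}$. Arithmetic operations and absolute values of vectors are entry-wise. For $x,y\in\mathbb{R}^m$, $x\prec_w y$ (weak majorization) means that, after rearranging the entries of each vector in decreasing order $x_1\ge\dots\ge x_m$, $y_1\ge\dots\ge y_m$, one has $\sum_{i=1}^k x_i\le\sum_{i=1}^k y_i$ for all $1\le k\le m$. *)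

(* Defs.v *)
From HB Require Import structures.
From mathcomp Require Import all_boot all_order all_algebra.
From mathcomp Require Import complex.
From mathcomp Require Import reals trigo.

Set Implicit Arguments.
Unset Strict Implicit.
Unset Printing Implicit Defensive.

Import Order.TTheory GRing.Theory Num.Theory.
Local Open Scope ring_scope.
Local Open Scope complex_scope.
Local Open Scope sesquilinear_scope.

Section RealVectors.
Context {R : realType} {m : nat}.
Implicit Types x y : 'rV[R]_m.

Definition decreasing x : 'rV[R]_m :=
  \row_i (sort >=%R [seq x 0 j | j <- enum 'I_m])`_i.

Definition absv x : 'rV[R]_m := map_mx (fun a : R => `|a|) x.

Definition weak_majorize x y : Prop :=
  forall k : nat, (1 <= k <= m)%N ->
    \sum_(i < m | (i < k)%N) decreasing x 0 i
      <= \sum_(i < m | (i < k)%N) decreasing y 0 i.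

(* The largest entry of a vector with nonnegative entries. *)
Definition maxentry x : R := \big[Num.max/0]_(i < m) x 0 i.

End RealVectors.

Notation "x '<w' y" := (weak_majorize x y) (at level 70, no associativity).

Section Matrices.
Context {R : realType}.
Local Notation C := R[i].

(* Roots of the characteristic polynomial, with multiplicity.  Only meant for
   Hermitian M, whose eigenvalues are real, so that Re loses nothing. *)
Definition eigvals m (M : 'M[C]_m) : 'rV[R]_m :=
  decreasing
    (\row_i complex.Re (sval (closed_field_poly_normal (char_poly M)))`_i).

(* Only meant for k <= m; otherwise k - m superfluous zeros are appended. *)
Definition singvals m k (M : 'M[C]_(m, k)) : 'rV[R]_k :=
  map_mx Num.sqrt (eigvals (M ^t* *m M)).

(* Subspaces of C^n are subspaces of the space of column vectors. *)
Definition orthonormal_basis n p (X : 'M[C]_(n, p))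
    (U : {vspace 'cV[C]_n}) : Prop :=
  basis_of U [seq col j X | j <- enum 'I_p] /\ X ^t* *m X = 1%:M.

(* proj_ortho acts on row vectors by right multiplication and projects onto a
   row space; hence the two transpositions. *)
Definition orthoproj n (U : {vspace 'cV[C]_n}) : 'M[C]_n :=
  (proj_ortho (\matrix_(i < \dim U) ((vbasis U)`_i)^T))^T.

Definition invariant_subspace n (A : 'M[C]_n) (U : {vspace 'cV[C]_n}) : Prop :=
  forall v, v \in U -> A *m v \in U.

Definition rayleigh n p (A : 'M[C]_n) (X : 'M[C]_(n, p)) : 'M[C]_p :=
  X ^t* *m A *m X.

Definition residual n p (A : 'M[C]_n) (X : 'M[C]_(n, p)) : 'M[C]_(n, p) :=
  A *m X - X *m rayleigh A X.

(* The angles between the spans of the columns of X and Y, when these columns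
   are orthonormal; they do not depend on the choice of the orthonormal
   bases. *)
Definition principal_angles n p (X Y : 'M[C]_(n, p)) : 'rV[R]_p :=
  decreasing (map_mx (@acos R) (singvals (X ^t* *m Y))).

Definition theta_max n p (X Y : 'M[C]_(n, p)) : R :=
  maxentry (principal_angles X Y).

End Matrices.

(* Main.v *)
Require Import Defs.
From mathcomp Require Import all_boot all_order perm all_algebra.
From mathcomp Require Import complex.
From mathcomp Require Import reals trigo.
From mathcomp Require Import ring lra.

Import Order.TTheory GRing.Theory Num.Theory.
Local Open Scope ring_scope.
Local Open Scope complex_scope.
Local Open Scope sesquilinear_scope.

(** Put H = X^* A X, K = Y^* A Y and M = X^* Y, a square matrix whose singular
values are the cosines of the principal angles.  Since X^* A Y can be computed
from either residual, H M - M K = X^* R_Y - (Y^* R_X)^*: the difference of the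
two Rayleigh quotients is governed by a Sylvester expression in the projected
residuals.

Let sigma = cos theta_max > 0 be the smallest singular value of M.  In the
polar decomposition M = W S one has S >= sigma, and D = W^* H W - K satisfies
W^* (H M - M K) = D S + (K S - S K).  On a unit eigenvector z of D with
eigenvalue d the commutator is skew-Hermitian and drops out of the real part,
so Re z^* W^* (H M - M K) z = d z^* S z, of absolute value at least sigma |d|.
Summing over the k eigenvalues of D of largest modulus, sigma times their sum
is at most Re tr (U^* (H M - M K) V) for two partial isometries U, V of rank at
most k ([sylvester_spectral_variation]).  The trace splits into two terms, one
for each residual, and by Ky Fan's inequality ([ky_fan]) each is at most a sum
of k largest singular values.

On the left, the eigenvalues of W^* H W are those of H, so what is needed is
Mirsky's inequality: any k of the numbers |lambda_i(K + D) - lambda_i(K)| add up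
to at most the sum of the k largest |lambda_j(D)|.  It follows from Lidskii's
inequality, in the threshold form of [lidskii]: raise K to K + P, with P the
part of D above a level t.  Weyl monotonicity makes all the eigenvalues grow,
and the total growth is the trace of P.

If the range of X is invariant, R_X = 0 and its term disappears. *)

Set Implicit Arguments.
Unset Strict Implicit.
Unset Printing Implicit Defensive.

(** * Decreasing rearrangements and sums of largest entries *)

Section RealSequences.
Variable R : realType.

Definition nonincreasing m (x : 'rV[R]_m) : Prop :=
  forall i j : 'I_m, (i <= j)%N -> x 0 j <= x 0 i.

Lemma size_sort_row m (x : 'rV[R]_m) :
  size (sort >=%R [seq x 0 j | j <- enum 'I_m]) = m.
Proof. by rewrite size_sort size_map size_enum_ord. Qed.

Lemma decreasing_nonincreasing m (x : 'rV[R]_m) : nonincreasing (decreasing x).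
Proof.
move=> i j le_ij; rewrite !mxE.
apply: (sorted_leq_nth (leT := >=%R)) => //.
- by move=> a b c /= ab ca; apply: le_trans ca ab.
- by move=> a /=.
- by apply: sort_sorted => a b; apply: real_leVge; rewrite num_real.
- by rewrite inE size_sort_row.
- by rewrite inE size_sort_row.
Qed.

Lemma perm_eq_enumP (T : eqType) m (s : seq T) (F : 'I_m -> T) (x0 : T) :
  perm_eq s [seq F j | j <- enum 'I_m] ->
  exists q : 'S_m, forall i : 'I_m, nth x0 s i = F (q i).
Proof.
move=> peq.
have tE : [seq F j | j <- enum 'I_m] = [tuple F j | j < m] :> seq T by [].
rewrite tE in peq; have [q qE] := tuple_permP peq.
exists q => i; rewrite qE -tnth_nth.
by rewrite !tnth_mktuple.
Qed.

Lemma decreasing_perm m (x : 'rV[R]_m) :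
  exists q : 'S_m, forall i, decreasing x 0 i = x 0 (q i).
Proof.
have peq : perm_eq (sort >=%R [seq x 0 j | j <- enum 'I_m])
                   [seq x 0 j | j <- enum 'I_m] by rewrite perm_sort.
have [q qE] := perm_eq_enumP 0 peq.
by exists q => i; rewrite mxE qE.
Qed.

Lemma decreasing_id m (x : 'rV[R]_m) :
  nonincreasing x -> decreasing x = x.
Proof.
move=> x_dec; apply/rowP => i; rewrite mxE.
rewrite sorted_sort.
- by rewrite (nth_map i) ?size_enum_ord // nth_ord_enum.
- by move=> a b c /= ab ca; apply: le_trans ca ab.
- rewrite sorted_map; apply/(sortedP i) => k; rewrite size_enum_ord => lt_km.
  have lt_k : (k < m)%N by apply: ltnW.
  rewrite /= (_ : k = Ordinal lt_k) // nth_ord_enum.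
  by rewrite (_ : k.+1 = Ordinal lt_km) // nth_ord_enum x_dec /=.
Qed.

Lemma sum_ord_lt m k : (k <= m)%N -> (\sum_(i < m | (i < k)%N) 1 = k)%N.
Proof.
move=> le_km; rewrite -(big_ord_widen _ (fun=> 1%N) le_km).
by rewrite sum1_card card_ord.
Qed.

(** Moving weight from beyond the k-th entry to entries above it can only
increase the sum: compare each [s i] with the threshold [s (k - 1)]. *)
Lemma weighted_sum_le m k (s w : 'I_m -> R) :
  (k <= m)%N ->
  (forall i j : 'I_m, (i <= j)%N -> s j <= s i) ->
  (forall i, 0 <= s i) -> (forall i, 0 <= w i <= 1) ->
  \sum_i w i <= k%:R ->
  \sum_i s i * w i <= \sum_(i < m | (i < k)%N) s i.
Proof.
move=> le_km s_dec s_ge0 w01 sum_w.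
case: k => [|k] in le_km sum_w *.
  have w0 i : w i = 0.
    apply/eqP; rewrite eq_le; apply/andP; split; last by case/andP: (w01 i).
    apply: le_trans sum_w; rewrite (bigD1 i) //= lerDl sumr_ge0 // => j _.
    by case/andP: (w01 j).
  by rewrite !big1 // => i _; rewrite w0 mulr0.
pose t := s (Ordinal le_km).
have -> : \sum_(i < m | (i < k.+1)%N) s i
    = k.+1%:R * t + \sum_(i < m | (i < k.+1)%N) (s i - t).
  rewrite sumrB sumr_const -sum1_card sum_ord_lt // mulr_natl.
  by rewrite addrC subrK.
have -> : \sum_i s i * w i = (\sum_i w i) * t + \sum_i (s i - t) * w i.
  rewrite mulr_suml -big_split; apply: eq_bigr => i _ /=.
  by rewrite mulrBl addrCA (mulrC t) subrr addr0.
apply: lerD; first by rewrite ler_wpM2r // s_ge0.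
rewrite [leRHS]big_mkcond; apply: ler_sum => i _.
have /andP[w0 w1] := w01 i.
case: ifP => [lt_ik|/negbT]; first by rewrite ler_piMr // subr_ge0 s_dec.
by rewrite -leqNgt => /ltnW lt_ki; rewrite mulr_le0_ge0 // subr_le0 s_dec.
Qed.

(** The sum of the k largest entries is the value of t |-> k t + sum (a_i - t)^+
at its minimiser, the k-th largest entry. *)
Lemma threshold_sum m k (a : 'I_m -> R) (q : 'S_m) :
  (0 < k <= m)%N -> (forall i, 0 <= a i) ->
  (forall i j : 'I_m, (i <= j)%N -> a (q j) <= a (q i)) ->
  exists2 t : R, 0 <= t &
    k%:R * t + \sum_i Num.max (a i - t) 0 = \sum_(i < m | (i < k)%N) a (q i).
Proof.
case: k => // k le_km a_ge0 a_dec; pose t := a (q (Ordinal le_km)).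
exists t; first exact: a_ge0.
rewrite (reindex_inj (@perm_inj _ q)) /=.
rewrite (bigID (fun i : 'I_m => (i < k.+1)%N)) /=.
rewrite [X in _ + (_ + X)]big1; last first.
  move=> i; rewrite -leqNgt => /ltnW le_ki; apply/max_idPr.
  by rewrite subr_le0 a_dec.
rewrite addr0 (eq_bigr (fun i => a (q i) - t)); last first.
  by move=> i le_ik; apply/max_idPl; rewrite subr_ge0 a_dec.
rewrite sumrB sumr_const -sum1_card sum_ord_lt // mulr_natl.
by rewrite addrC subrK.
Qed.

End RealSequences.

(** * Quadratic forms and orthonormal eigenbases *)

Section ComplexMatrices.
Variable R : realType.
Local Notation C := R[i].
Local Notation Re := complex.Re.
Local Notation Im := complex.Im.

Definition sqmod (z : C) : R := Re z ^+ 2 + Im z ^+ 2.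

Lemma sqmod_ge0 z : 0 <= sqmod z.
Proof. by rewrite addr_ge0 // sqr_ge0. Qed.

Lemma ReD (x y : C) : Re (x + y) = Re x + Re y.
Proof. by case: x y => [a b] [c d]. Qed.

Lemma ReB (x y : C) : Re (x - y) = Re x - Re y.
Proof. by case: x y => [a b] [c d]. Qed.

Lemma Re_sum (I : Type) (r : seq I) (P : pred I) (F : I -> C) :
  Re (\sum_(i <- r | P i) F i) = \sum_(i <- r | P i) Re (F i).
Proof.
by elim/big_rec2: _ => [|i y x _ <-]; rewrite ?ReD.
Qed.

Lemma ReM_real (a : R) (z : C) : Re (a%:C * z) = a * Re z.
Proof. by case: z => c d /=; rewrite mul0r subr0. Qed.

Lemma Re_adj (z : C) : Re (Num.conj z) = Re z.
Proof. by case: z. Qed.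

Lemma conj_real (a : R) : Num.conj (a%:C : C) = a%:C.
Proof. exact: conjc_real. Qed.

Lemma conjM_sqmod (z : C) : Num.conj z * z = (sqmod z)%:C.
Proof.
case: z => a b; apply/eqP; rewrite eq_complex /sqmod /= !expr2.
by rewrite mulNr opprK eqxx /= mulrC mulNr subrr.
Qed.

Lemma sqmod_conj (z : C) : sqmod (Num.conj z) = sqmod z.
Proof. by case: z => a b; rewrite /sqmod /= sqrrN. Qed.

Lemma sqmod_eq0 (z : C) : (sqmod z == 0) = (z == 0).
Proof.
case: z => a b; rewrite /sqmod paddr_eq0 ?sqr_ge0 // !sqrf_eq0.
by rewrite eq_complex.
Qed.

Lemma ReM_le (x y : C) : Re (x * y) <= 2^-1 * (sqmod x + sqmod y).
Proof.
case: x y => [a b] [c d]; rewrite /sqmod /=.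
by have := sqr_ge0 (a - c); have := sqr_ge0 (b + d); nra.
Qed.

Lemma adjmxM m n p (A : 'M[C]_(m, n)) (B : 'M[C]_(n, p)) :
  (A *m B)^t* = B^t* *m A^t*.
Proof. by rewrite trmx_mul map_mxM. Qed.

Lemma adjmxD m n (A B : 'M[C]_(m, n)) : (A + B)^t* = A^t* + B^t*.
Proof. by rewrite linearD /= map_mxD. Qed.

Lemma adjmxN m n (A : 'M[C]_(m, n)) : (- A)^t* = - A^t*.
Proof. by rewrite linearN /= map_mxN. Qed.

Lemma adjmxB m n (A B : 'M[C]_(m, n)) : (A - B)^t* = A^t* - B^t*.
Proof. by rewrite linearB /= map_mxB. Qed.

Lemma gram_diag m n (K : 'M[C]_(m, n)) i :
  (K^t* *m K) i i = (\sum_j sqmod (K j i))%:C.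
Proof.
by rewrite !mxE rmorph_sum; apply: eq_bigr => j _; rewrite !mxE conjM_sqmod.
Qed.

Lemma Re_gram_diag m n (K : 'M[C]_(m, n)) i :
  Re ((K^t* *m K) i i) = \sum_j sqmod (K j i).
Proof. by rewrite gram_diag. Qed.

Lemma Re_tr_gram m n (K : 'M[C]_(m, n)) :
  Re (\tr (K^t* *m K)) = \sum_i \sum_j sqmod (K j i).
Proof.
by rewrite /mxtrace Re_sum; apply: eq_bigr => i _; rewrite gram_diag.
Qed.

(** V V^* is an orthogonal projector, so V^* does not increase the norm of a
column: the defect is the squared norm of the column of K - V V^* K. *)
Lemma partial_isometry_le m n p (V : 'M[C]_(m, n)) (K : 'M[C]_(m, p)) i :
  V *m V^t* *m V = V ->
  \sum_j sqmod ((V^t* *m K) j i) <= \sum_j sqmod (K j i).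
Proof.
move=> VV; rewrite -!Re_gram_diag -subr_ge0 -ReB.
set P := V *m V^t*.
have PP : P *m P = P by rewrite /P mulmxA VV.
have Pt : P^t* = P by rewrite adjmxM trmxCK.
pose L := K - P *m K.
have -> : (K^t* *m K) i i - ((V^t* *m K)^t* *m (V^t* *m K)) i i
        = (L^t* *m L) i i.
  have -> : L^t* *m L = K^t* *m K - (V^t* *m K)^t* *m (V^t* *m K).
    rewrite /L adjmxB adjmxM Pt mulmxBl !mulmxBr.
    rewrite -(mulmxA _ P (P *m K)) (mulmxA P P) PP -(mulmxA _ P K) subrr subr0.
    congr (_ - _).
    by rewrite adjmxM trmxCK !mulmxA.
  by rewrite !mxE.
by rewrite Re_gram_diag sumr_ge0 // => j _; apply: sqmod_ge0.
Qed.

Definition rdiag n (d : 'rV[R]_n) : 'M[C]_n :=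
  diag_mx (map_mx (real_complex R) d).

Lemma adj_rdiag n (d : 'rV[R]_n) : (rdiag d)^t* = rdiag d.
Proof.
apply/matrixP => i j; rewrite !mxE eq_sym; case: eqP => [->|_].
  by rewrite !mulr1n conj_real.
by rewrite !mulr0n rmorph0.
Qed.

Lemma Re_rdiag n (d : 'rV[R]_n) j : Re (rdiag d j j) = d 0 j.
Proof. by rewrite mxE eqxx mulr1n mxE. Qed.

Lemma rdiagM n (d e : 'rV[R]_n) :
  rdiag d *m rdiag e = rdiag (\row_j (d 0 j * e 0 j)).
Proof.
rewrite mulmx_diag; congr diag_mx; apply/rowP => j.
by rewrite !mxE rmorphM.
Qed.

Lemma rdiag1 n : rdiag (const_mx 1 : 'rV[R]_n) = 1%:M.
Proof. by rewrite -diag_const_mx /rdiag map_const_mx. Qed.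

Lemma mulmx_rdiag m n (K : 'M[C]_(m, n)) d i j :
  (K *m rdiag d) i j = (d 0 j)%:C * K i j.
Proof. by rewrite mul_mx_diag !mxE mulrC. Qed.

Lemma rdiag_mulmx m n (K : 'M[C]_(m, n)) d i j :
  (rdiag d *m K) i j = (d 0 i)%:C * K i j.
Proof. by rewrite mul_diag_mx !mxE. Qed.

Definition eigenbasis n (M Q : 'M[C]_n) (d : 'rV[R]_n) : Prop :=
  Q^t* *m Q = 1%:M /\ M = Q *m rdiag d *m Q^t*.

(** The quadratic form of M at the i-th column of v.  For Hermitian M its value
is real, so that [Re] loses nothing. *)
Definition qform n p (M : 'M[C]_n) (v : 'M[C]_(n, p)) i : R :=
  Re ((v^t* *m M *m v) i i).

Lemma qformE n p (M : 'M[C]_n) (v : 'M[C]_(n, p)) i :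
  qform M v i = Re ((v^t* *m M *m v) i i).
Proof. by []. Qed.

Lemma qformD n p (A B : 'M[C]_n) (v : 'M[C]_(n, p)) i :
  qform (A + B) v i = qform A v i + qform B v i.
Proof. by rewrite /qform mulmxDr mulmxDl mxE ReD. Qed.

Section Eigenbasis.
Variables (n : nat) (M Q : 'M[C]_n) (d : 'rV[R]_n).
Hypothesis MQ : eigenbasis M Q d.

Lemma eigenbasisQV : Q *m Q^t* = 1%:M.
Proof. exact: mulmx1C MQ.1. Qed.

Lemma eigenbasis_adj : M^t* = M.
Proof. by rewrite MQ.2 !adjmxM trmxCK adj_rdiag mulmxA. Qed.

Lemma eigenbasis_diag : Q^t* *m M *m Q = rdiag d.
Proof.
by rewrite MQ.2 !mulmxA MQ.1 mul1mx -mulmxA MQ.1 mulmx1.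
Qed.

Lemma eigenbasis_qform p (v : 'M[C]_(n, p)) i :
  qform M v i = \sum_j d 0 j * sqmod ((Q^t* *m v) j i).
Proof.
have VE : v^t* *m M *m v = (Q^t* *m v)^t* *m (rdiag d *m (Q^t* *m v)).
  by rewrite MQ.2 adjmxM trmxCK !mulmxA.
rewrite /qform VE mxE Re_sum; apply: eq_bigr => j _.
rewrite rdiag_mulmx mulrCA ReM_real; congr (_ * _).
by rewrite !mxE conjM_sqmod.
Qed.

Lemma eigenbasis_norm p (v : 'M[C]_(n, p)) i :
  \sum_j sqmod ((Q^t* *m v) j i) = \sum_j sqmod (v j i).
Proof.
rewrite -!Re_gram_diag adjmxM trmxCK mulmxA -(mulmxA _ Q) eigenbasisQV.
by rewrite mulmx1.
Qed.

Lemma eigenbasis_tr : \tr M = (\sum_j d 0 j)%:C.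
Proof.
rewrite MQ.2 mxtrace_mulC mulmxA MQ.1 mul1mx mxtrace_diag rmorph_sum.
by apply: eq_bigr => j _; rewrite mxE.
Qed.

End Eigenbasis.

Lemma char_poly_conj n (P D : 'M[C]_n) :
  P \in unitmx -> char_poly (invmx P *m D *m P) = char_poly D.
Proof.
move=> uP; rewrite /char_poly.
pose P' := map_mx (polyC : C -> {poly C}) P.
pose P'V := map_mx (polyC : C -> {poly C}) (invmx P).
have PV : P'V *m P' = 1%:M by rewrite -map_mxM mulVmx // map_mx1.
have -> : char_poly_mx (invmx P *m D *m P) = P'V *m char_poly_mx D *m P'.
  rewrite /char_poly_mx mulmxBr mulmxBl !map_mxM.
  by rewrite mul_mx_scalar -scalemxAl PV scalemx1.
rewrite !det_mulmx mulrC mulrA [_ * \det P'V]mulrC -det_mulmx PV det1 mul1r.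
by [].
Qed.

Lemma char_poly_diag n (d : 'rV[C]_n) :
  char_poly (diag_mx d) = \prod_(z <- [seq d 0 j | j <- enum 'I_n]) ('X - z%:P).
Proof.
rewrite char_poly_trig ?diag_mx_is_trig // big_map big_enum /=.
by apply: eq_bigr => i _; rewrite mxE eqxx mulr1n.
Qed.

(** The spectral theorem gives an eigenbasis in an arbitrary order; the
characteristic polynomial determines the eigenvalues up to a permutation, and
permuting the eigenvectors accordingly puts them in the order of [eigvals]. *)
Lemma eigvals_basis n (M : 'M[C]_n) :
  M^t* = M -> exists Q, eigenbasis M Q (eigvals M).
Proof.
move=> Mherm.
have hM : M \is hermsymmx by apply/is_hermitianmxP; rewrite expr0 scale1r Mherm.
have /orthomx_spectralP ME := hermitian_normalmx hM.
have e_real := hermitian_spectral_diag_real hM.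
set P := spectralmx M in ME; set e := spectral_diag M in ME e_real.
have uP : P \is unitarymx := spectral_unitarymx M.
have PV : invmx P = P^t* by apply: invmx_unitary.
set rs := sval (closed_field_poly_normal (char_poly M)).
have rsE : \prod_(z <- rs) ('X - z%:P) = char_poly M.
  rewrite /rs; case: (closed_field_poly_normal _) => r /= rE.
  by rewrite [RHS]rE (monicP (char_poly_monic M)) scale1r.
have rs_e : perm_eq rs [seq e 0 j | j <- enum 'I_n].
  apply: prod_XsubC_eq; rewrite rsE.
  rewrite [in LHS]ME char_poly_conj ?unitarymx_unit //.
  exact: char_poly_diag.
have [q1 q1E] := perm_eq_enumP 0 rs_e.
have [q2 q2E] := decreasing_perm (\row_(i < n) Re rs`_i).
pose q := (q2 * q1)%g.
have qE i : e 0 (q i) = (eigvals M 0 i)%:C.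
  rewrite /eigvals q2E mxE q1E permM RRe_real //.
  by move/mxOverP: e_real; apply.
exists (col_perm q (P^t* )); split.
  apply/matrixP => i j; transitivity ((P *m P^t*) (q i) (q j)).
    by rewrite !mxE; apply: eq_bigr => k _; rewrite !mxE conjCK.
  by rewrite (unitarymxP uP) !mxE (inj_eq perm_inj).
apply/matrixP => i j; rewrite [in LHS]ME PV mxE [RHS]mxE.
rewrite (reindex_inj (@perm_inj _ q)) /=; apply: eq_bigr => k _.
rewrite mul_mx_diag mulmx_rdiag -qE !mxE conjCK.
by rewrite [_ * e 0 _]mulrC.
Qed.

End ComplexMatrices.

(* Comparing two quadratic forms by conversion would unfold the matrix products
   inside; from here on they are handled through the lemmas above. *)
#[global] Opaque qform.

(** * Eigenvalue inequalities of Weyl, Lidskii and Mirsky *)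

Section Majorization.
Variable R : realType.
Local Notation C := R[i].
Local Notation Re := complex.Re.
Local Notation Im := complex.Im.

Lemma rdiag_eigenbasis n (Q : 'M[C]_n) (d : 'rV[R]_n) :
  Q^t* *m Q = 1%:M -> eigenbasis (Q *m rdiag d *m Q^t* ) Q d.
Proof. by []. Qed.

(** The conditions that v is orthogonal to the eigenvectors of B before i and to
those of A after i are n - 1 linear equations, so some v <> 0 satisfies them.
On such a v the form of A is at least a_i |v|^2 and that of B at most
b_i |v|^2. *)
Lemma weyl_monotone n (A B Q1 Q2 : 'M[C]_n) (a b : 'rV[R]_n) t :
  eigenbasis A Q1 a -> eigenbasis B Q2 b ->
  nonincreasing a ->
  nonincreasing b ->
  (forall v : 'cV[C]_n,
     qform A v 0 <= qform B v 0 + t * \sum_j sqmod (v j 0)) ->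
  forall i, a 0 i <= b 0 i + t.
Proof.
move=> Aa Bb a_dec b_dec le_AB i.
(* Row i is zero, which makes Z singular; the other rows are the equations. *)
pose Z : 'M[C]_n := \matrix_(j, k) if (j < i)%N then (Q2^t* ) j k else
                          if (i < j)%N then (Q1^t* ) j k else 0.
have : \det Z^T == 0.
  rewrite det_tr (expand_det_row _ i) big1 // => k _.
  by rewrite mxE ltnn mul0r.
case/det0P => w w_neq0 /(congr1 trmx); rewrite trmx_mul trmxK trmx0.
set v := w^T => Zv.
have v2 (j : 'I_n) : (j < i)%N -> (Q2^t* *m v) j 0 = 0.
  move=> ltji; have /matrixP/(_ j 0) := Zv; rewrite mxE [RHS]mxE => <-.
  by rewrite mxE; apply: eq_bigr => k _; rewrite [in RHS]mxE ltji.
have v1 (j : 'I_n) : (i < j)%N -> (Q1^t* *m v) j 0 = 0.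
  move=> ltij; have /matrixP/(_ j 0) := Zv; rewrite mxE [RHS]mxE => <-.
  rewrite mxE; apply: eq_bigr => k _; rewrite [in RHS]mxE ltij.
  by rewrite ltnNge ltnW.
have N_gt0 : 0 < \sum_j sqmod (v j 0).
  rewrite lt_neqAle sumr_ge0 ?andbT; last by move=> j _; apply: sqmod_ge0.
  apply: contra w_neq0; rewrite eq_sym psumr_eq0; last first.
    by move=> j _; apply: sqmod_ge0.
  move=> /allP v0; apply/eqP/rowP => j; rewrite mxE.
  have := v0 j; rewrite mem_index_enum sqmod_eq0 mxE => /(_ isT) /eqP.
  by [].
have := le_AB v; rewrite (eigenbasis_qform Aa) (eigenbasis_qform Bb) => le_ab.
rewrite -(ler_pM2r N_gt0) mulrDl.
have le_a : a 0 i * \sum_j sqmod (v j 0)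
    <= \sum_j a 0 j * sqmod ((Q1^t* *m v) j 0).
  rewrite -(eigenbasis_norm Aa) mulr_sumr; apply: ler_sum => j _.
  have [ltij|leji] := ltnP i j; last by rewrite ler_wpM2r ?sqmod_ge0 ?a_dec.
  by rewrite v1 // (eqP (_ : sqmod 0 == 0)) ?sqmod_eq0 // !mulr0.
have le_b : \sum_j b 0 j * sqmod ((Q2^t* *m v) j 0)
    <= b 0 i * \sum_j sqmod (v j 0).
  rewrite -(eigenbasis_norm Bb) mulr_sumr; apply: ler_sum => j _.
  have [ltij|leji] := ltnP j i; last by rewrite ler_wpM2r ?sqmod_ge0 ?b_dec.
  by rewrite v2 // (eqP (_ : sqmod 0 == 0)) ?sqmod_eq0 // !mulr0.
apply: le_trans le_a _; apply: le_trans le_ab _.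
by rewrite lerD2r.
Qed.

Lemma eigvals_nonincreasing n (M : 'M[C]_n) : nonincreasing (eigvals M).
Proof. exact: decreasing_nonincreasing. Qed.

Section Lidskii.
Variables (n : nat) (Z : 'M[C]_n).
Implicit Types (A B : 'M[C]_n) (d : 'rV[R]_n).

(** Let P be the part of D above the level t.  Then B + D <= B + P + t, so a_i
exceeds the i-th eigenvalue of B + P by at most t; and B <= B + P, so every
eigenvalue of B + P exceeds that of B, which allows enlarging the sum over I to
the whole trace of P. *)
Lemma lidskii A B D Q1 Q2 a b d (t : R) (I : pred 'I_n) :
  eigenbasis A Q1 a -> eigenbasis B Q2 b ->
  nonincreasing a ->
  nonincreasing b ->
  A = B + D -> eigenbasis D Z d ->
  \sum_(i | I i) (a 0 i - b 0 i)
    <= #|I|%:R * t + \sum_j Num.max (d 0 j - t) 0.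
Proof.
move=> Aa Bb a_dec b_dec AE Dd.
pose e : 'rV[R]_n := \row_j Num.max (d 0 j - t) 0.
have [P Pe] : exists P, eigenbasis P Z e.
  by exists (Z *m rdiag e *m Z^t* ); apply: rdiag_eigenbasis Dd.1.
have BPherm : (B + P)^t* = B + P.
  by rewrite adjmxD (eigenbasis_adj Bb) (eigenbasis_adj Pe).
have [c [Q3 Pc c_dec]] : exists c : 'rV[R]_n,
    exists2 Q3, eigenbasis (B + P) Q3 c & nonincreasing c.
  have [Q3 Pc] := eigvals_basis BPherm.
  by exists (eigvals (B + P)), Q3 => //; apply: eigvals_nonincreasing.
have le_a i : a 0 i <= c 0 i + t.
  apply: (weyl_monotone Aa Pc) i => // v.
  rewrite AE 2!qformD (eigenbasis_qform Dd) (eigenbasis_qform Pe).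
  rewrite -addrA lerD2l -(eigenbasis_norm Dd) mulr_sumr -big_split.
  apply: ler_sum => j _ /=.
  by rewrite -mulrDl ler_wpM2r ?sqmod_ge0 // mxE -lerBlDr le_max lexx.
have le_b i : b 0 i <= c 0 i.
  rewrite -[leRHS]addr0; apply: (weyl_monotone Bb Pc) i => // v.
  rewrite mul0r addr0 qformD lerDl (eigenbasis_qform Pe) sumr_ge0 // => j _.
  by rewrite mulr_ge0 ?sqmod_ge0 // mxE le_max lexx orbT.
have trP : \sum_i (c 0 i - b 0 i) = \sum_j e 0 j.
  have := mxtraceD B P.
  rewrite (eigenbasis_tr Pc) (eigenbasis_tr Bb) (eigenbasis_tr Pe) -rmorphD.
  move=> /complexI trE.
  by rewrite sumrB trE addrC addKr.
rewrite (_ : \sum_j Num.max _ _ = \sum_j e 0 j); last first.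
  by apply: eq_bigr => j _; rewrite mxE.
rewrite -trP mulr_natl -sumr_const.
apply: (@le_trans _ _ (\sum_(i in I) t +
         \sum_(i in I) (c 0 i - b 0 i))).
  rewrite -big_split; apply: ler_sum => i _ /=.
  by rewrite addrA lerD2r addrC.
rewrite lerD2l [leLHS]big_mkcond; apply: ler_sum => i _.
by case: ifP; rewrite // subr_ge0.
Qed.

(** Apply [lidskii] to the indices with a_i >= b_i, and, exchanging A and B, to
the others: the parts of D above t and of -D above t have disjoint supports, as
t >= 0. *)
Lemma mirsky A B D Q1 Q2 a b d (t : R) (I : pred 'I_n) :
  eigenbasis A Q1 a -> eigenbasis B Q2 b ->
  nonincreasing a ->
  nonincreasing b ->
  A = B + D -> eigenbasis D Z d -> 0 <= t ->
  \sum_(i | I i) `|a 0 i - b 0 i|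
    <= #|I|%:R * t + \sum_j Num.max (`|d 0 j| - t) 0.
Proof.
move=> Aa Bb a_dec b_dec AE Dd t_ge0.
have BE : B = A + - D by rewrite AE addrK.
have NDd : eigenbasis (- D) Z (- d).
  split; first exact: Dd.1.
  by rewrite [in LHS]Dd.2 /rdiag map_mxN linearN /= mulmxN mulNmx.
pose pos := [pred i | I i && (b 0 i <= a 0 i)].
pose neg := [pred i | I i && ~~ (b 0 i <= a 0 i)].
have card_I : (#|I| = #|pos| + #|neg|)%N.
  rewrite -(cardID [pred i | b 0 i <= a 0 i] I).
  congr (_ + _)%N; apply: eq_card => i; rewrite !inE //.
  by rewrite andbC.
have maxE j : Num.max (d 0 j - t) 0 + Num.max ((- d) 0 j - t) 0
            = Num.max (`|d 0 j| - t) 0.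
  rewrite [(- d) 0 j]mxE; have [d_ge0|/ltW d_le0] := leP 0 (d 0 j).
    rewrite ger0_norm // [X in _ + X]max_r ?addr0 //.
    by rewrite subr_le0 (le_trans _ t_ge0) // oppr_le0.
  rewrite ler0_norm // [X in X + _]max_r ?add0r // subr_le0.
  exact: le_trans d_le0 t_ge0.
have := lerD (lidskii t pos Aa Bb a_dec b_dec AE Dd)
             (lidskii t neg Bb Aa b_dec a_dec BE NDd).
rewrite addrACA -mulrDl -natrD -card_I -big_split /=.
rewrite (eq_bigr _ (fun j _ => maxE j)).
apply: le_trans.
rewrite (bigID (fun i => b 0 i <= a 0 i)) /=.
rewrite lerD // ler_sum // => i /andP[_].
  by move=> ba; rewrite ger0_norm // subr_ge0.
by rewrite -ltNge => /ltW ab; rewrite distrC ger0_norm // subr_ge0.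
Qed.

End Lidskii.

(** * Singular values and Ky Fan's inequality *)

Section SingularValues.
Variables (m n : nat) (M : 'M[C]_(m, n)).

Lemma singvals_ge0 j : 0 <= singvals M 0 j.
Proof. by rewrite mxE sqrtr_ge0. Qed.

Lemma singvals_nonincreasing : nonincreasing (singvals M).
Proof.
move=> i j le_ij.
by rewrite [leLHS]mxE [leRHS]mxE ler_wsqrtr ?eigvals_nonincreasing.
Qed.

Lemma singvals_basis :
  exists Q, eigenbasis (M^t* *m M) Q (\row_j singvals M 0 j ^+ 2).
Proof.
have [|Q MQ] := @eigvals_basis R n (M^t* *m M); first by rewrite adjmxM trmxCK.
exists Q; suff <- : eigvals (M^t* *m M) = \row_j singvals M 0 j ^+ 2 by [].
apply/rowP => j; rewrite [RHS]mxE [singvals _ _ _]mxE sqr_sqrtr //.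
have /matrixP/(_ j j)/(congr1 (@complex.Re R)) := eigenbasis_diag MQ.
have -> : Q^t* *m (M^t* *m M) *m Q = (M *m Q)^t* *m (M *m Q).
  by rewrite adjmxM !mulmxA.
rewrite Re_gram_diag Re_rdiag => <-.
by rewrite sumr_ge0 // => i _; apply: sqmod_ge0.
Qed.

End SingularValues.

(** Partial isometries of rank at most k: U^* U is a projector and its trace is
the rank. *)
Definition isometry_rank_le m n k (U : 'M[C]_(m, n)) : Prop :=
  U *m U^t* *m U = U /\ Re (\tr (U^t* *m U)) <= k%:R.

(** Expand along the singular vectors, M q_j = s_j w_j.  The trace becomes the
sum of s_j times an inner product of the j-th rows of W^* U and Q^* V, which the
mean of the squared norms of these rows bounds.  These means lie in [0, 1] and
add up to at most k, so [weighted_sum_le] applies. *)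
Lemma ky_fan m n r k (M : 'M[C]_(m, n)) (U : 'M[C]_(m, r)) (V : 'M[C]_(n, r)) :
  (k <= n)%N -> isometry_rank_le k U -> isometry_rank_le k V ->
  Re (\tr (U^t* *m M *m V)) <= \sum_(i < n | (i < k)%N) singvals M 0 i.
Proof.
move=> le_kn [UU trU] [VV trV].
have [Q MQ] := singvals_basis M.
pose s := singvals M.
(* The inverse of 0 being 0, the columns of W for zero singular values vanish
   and W is only a partial isometry. *)
pose W := M *m Q *m rdiag (\row_j (s 0 j)^-1).
have MQd : (M *m Q)^t* *m (M *m Q) = rdiag (\row_j s 0 j ^+ 2).
  by rewrite -(eigenbasis_diag MQ) adjmxM !mulmxA.
have MQ0 j i : s 0 j = 0 -> (M *m Q) i j = 0.
  move=> sj0; have /matrixP/(_ j j)/(congr1 (@complex.Re R)) := MQd.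
  rewrite Re_gram_diag Re_rdiag [(\row__ _) 0 j]mxE sj0 expr0n /=.
  move/eqP; rewrite psumr_eq0 => [/allP/(_ i)|l _]; last exact: sqmod_ge0.
  by rewrite mem_index_enum sqmod_eq0 => /(_ isT)/eqP.
have WE : M *m Q = W *m rdiag s.
  apply/matrixP => i j; rewrite !mulmx_rdiag [(\row__ _) 0 j]mxE.
  rewrite mulrA -rmorphM /=.
  have [sj0|sj0] := eqVneq (s 0 j) 0; first by rewrite MQ0 // mulr0.
  by rewrite divff // mul1r.
pose ind : 'rV[R]_n := \row_j (s 0 j != 0)%:R.
have WW : W^t* *m W = rdiag ind.
  rewrite /W adjmxM adj_rdiag -mulmxA (mulmxA _ (M *m Q)) MQd !rdiagM.
  congr rdiag; apply/rowP => j; rewrite mxE.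
  do 3![rewrite [(\row__ _) 0 j]mxE]; rewrite [RHS]mxE.
  have [->|sj0] := eqVneq (s 0 j) 0; first by rewrite invr0 mul0r.
  by rewrite /= [(\row__ _) 0 j]mxE; field.
have WWW : W *m W^t* *m W = W.
  rewrite -mulmxA WW; apply/matrixP => i j; rewrite mulmx_rdiag.
  rewrite /W mulmx_rdiag [ind _ _]mxE [(\row__ _) 0 j]mxE.
  have [->|sj0] := eqVneq (s 0 j) 0.
    by rewrite invr0 !mul0r.
  by rewrite mul1r.
pose G := Q^t* *m V; pose T := W^t* *m U.
pose w j := 2^-1 * (\sum_i sqmod (T j i) + \sum_i sqmod (G j i)).
have -> : \tr (U^t* *m M *m V) = \sum_j (s 0 j)%:C * \sum_i (T^t* ) i j * G j i.
  have -> : U^t* *m M *m V = T^t* *m (rdiag s *m G).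
    rewrite adjmxM trmxCK (mulmxA _ (rdiag s)) -(mulmxA _ W) -WE !mulmxA.
    by rewrite -(mulmxA _ Q) (eigenbasisQV MQ) mulmx1.
  rewrite /mxtrace; under eq_bigr do rewrite mxE.
  rewrite exchange_big; apply: eq_bigr => j _; rewrite mulr_sumr /=.
  by apply: eq_bigr => i _; rewrite rdiag_mulmx mulrCA.
apply: (@le_trans _ _ (\sum_j s 0 j * w j)).
  rewrite Re_sum; apply: ler_sum => j _; rewrite ReM_real.
  rewrite ler_wpM2l ?singvals_ge0 // /w Re_sum -big_split mulr_sumr.
  apply: ler_sum => i _; apply: le_trans (ReM_le _ _) _ => /=.
  by rewrite [(T^t* ) _ _]mxE [T^T _ _]mxE sqmod_conj.
have sum_adj p1 p2 p3 (K : 'M[C]_(p1, p2)) (L : 'M[C]_(p1, p3)) j :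
    \sum_i sqmod ((K^t* *m L) j i) = \sum_i sqmod ((L^t* *m K) i j).
  apply: eq_bigr => i _.
  by rewrite -{1}[L]trmxCK -adjmxM 2!mxE sqmod_conj.
apply: weighted_sum_le => //.
- exact: singvals_nonincreasing.
- exact: singvals_ge0.
- move=> j; rewrite /w; apply/andP; split.
    by rewrite mulr_ge0 ?invr_ge0 ?ler0n // addr_ge0 ?sumr_ge0 // => *;
       apply: sqmod_ge0.
  rewrite ler_pdivrMl ?ltr0n // mulr1 -[2]/(1 + 1)%R lerD //.
    rewrite sum_adj; apply: le_trans (partial_isometry_le _ _ UU) _.
    rewrite -Re_gram_diag WW Re_rdiag mxE.
    by case: (_ != _); rewrite ?lexx ?ler01.
  rewrite sum_adj; apply: le_trans (partial_isometry_le _ _ VV) _.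
  by rewrite -Re_gram_diag MQ.1 mxE eqxx.
rewrite -mulr_sumr ler_pdivrMl ?ltr0n // big_split mulr_natl mulr2n /=.
rewrite lerD //.
  apply: le_trans trU; rewrite Re_tr_gram exchange_big /=.
  by apply: ler_sum => i _; apply: partial_isometry_le.
apply: le_trans trV; rewrite Re_tr_gram exchange_big /=.
by apply: ler_sum => i _; rewrite (eigenbasis_norm MQ).
Qed.

End Majorization.

(** * Spectral variation through a Sylvester expression *)

Section Core.
Variable R : realType.
Local Notation C := R[i].
Local Notation Re := complex.Re.

Lemma Re_skew_diag n (T : 'M[C]_n) i : Re ((T - T^t* ) i i) = 0.
Proof. by rewrite !mxE ReB Re_adj subrr. Qed.

(** S is the positive square root of M^* M and W = M S^-1; the eigenvalues of S
are the singular values of M, whence the lower bound on its quadratic form. *)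
Lemma polar_decomposition n (M : 'M[C]_n) (sigma : R) :
  0 < sigma -> (forall j, sigma <= singvals M 0 j) ->
  exists W S : 'M[C]_n,
    [/\ W^t* *m W = 1%:M, S^t* = S, M = W *m S &
        forall p (v : 'M[C]_(n, p)) i,
          sigma * \sum_j sqmod (v j i) <= qform S v i].
Proof.
move=> sigma_gt0 le_s; have [Q MQ] := singvals_basis M.
set s := singvals M in MQ le_s.
have s_neq0 j : s 0 j != 0 by rewrite gt_eqF // (lt_le_trans sigma_gt0).
have [S Ss] : exists S, eigenbasis S Q s.
  by exists (Q *m rdiag s *m Q^t* ); apply: rdiag_eigenbasis MQ.1.
have [V Vs] : exists V, eigenbasis V Q (\row_j (s 0 j)^-1).
  exists (Q *m rdiag (\row_j (s 0 j)^-1) *m Q^t* ).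
  exact: rdiag_eigenbasis MQ.1.
have VS : V *m S = 1%:M.
  rewrite Vs.2 Ss.2 !mulmxA -(mulmxA _ (Q^t* )) MQ.1 mulmx1.
  rewrite -(mulmxA Q (rdiag _) (rdiag _)) rdiagM.
  rewrite (_ : \row_j _ = const_mx 1); last first.
    apply/rowP => j; rewrite [LHS]mxE [(\row__ _) 0 j]mxE [RHS]mxE.
    by rewrite mulVf.
  by rewrite rdiag1 mulmx1 (eigenbasisQV MQ).
have MM : M^t* *m M = S *m S.
  rewrite [LHS]MQ.2 Ss.2 !mulmxA -(mulmxA _ (Q^t*) ) MQ.1 mulmx1.
  rewrite -(mulmxA Q (rdiag _) (rdiag _)) rdiagM.
  by congr (Q *m rdiag _ *m _); apply/rowP => j;
     rewrite [LHS]mxE [RHS]mxE expr2.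
exists (M *m V), S; split.
- rewrite adjmxM (eigenbasis_adj Vs) -mulmxA (mulmxA _ M) MM !mulmxA VS mul1mx.
  exact: mulmx1C.
- exact: eigenbasis_adj Ss.
- by rewrite -mulmxA VS mulmx1.
move=> p v i; rewrite (eigenbasis_qform Ss) -(eigenbasis_norm Ss) mulr_sumr.
by apply: ler_sum => j _; rewrite ler_wpM2r ?sqmod_ge0.
Qed.

Lemma isometry_rank_leM m n r k (X : 'M[C]_(m, n)) (U : 'M[C]_(n, r)) :
  X^t* *m X = 1%:M -> isometry_rank_le k U -> isometry_rank_le k (X *m U).
Proof.
move=> XX [UU trU]; split.
  rewrite adjmxM !mulmxA -(mulmxA _ (X^t*) ) XX mulmx1.
  by rewrite -!mulmxA (mulmxA U) UU.
by rewrite adjmxM -mulmxA (mulmxA _ X) XX mul1mx.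
Qed.

Lemma isometry_rank_leN m n k (U : 'M[C]_(m, n)) :
  isometry_rank_le k U -> isometry_rank_le k (- U).
Proof.
move=> [UU trU]; split.
  by rewrite adjmxN !(mulmxN, mulNmx) !opprK UU.
by rewrite adjmxN mulmxN mulNmx opprK.
Qed.

Lemma isometry_rank_le_diag m n k (Z : 'M[C]_(m, n)) (e : 'rV[R]_n) :
  Z^t* *m Z = 1%:M -> (forall j, e 0 j ^+ 3 = e 0 j) ->
  \sum_j e 0 j ^+ 2 <= k%:R -> isometry_rank_le k (Z *m rdiag e).
Proof.
move=> ZZ e3 sum_e; apply: isometry_rank_leM => //; split.
  rewrite adj_rdiag !rdiagM; congr rdiag; apply/rowP => j.
  by rewrite mxE [(\row__ _) 0 j]mxE -expr2 -exprSr e3.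
rewrite adj_rdiag rdiagM /mxtrace Re_sum (le_trans _ sum_e) //.
by apply: ler_sum => j _; rewrite Re_rdiag mxE expr2.
Qed.

(** U and V carry the eigenvectors z_j of D for the k eigenvalues of largest
modulus; U moreover multiplies z_j by the sign of its eigenvalue and rotates it
by the unitary polar factor W.  Then each of these k eigenvectors contributes to
the trace at least sigma times the modulus of its eigenvalue, and [mirsky], at
the threshold of [threshold_sum], bounds the left-hand side by sigma times the
sum of these moduli. *)
Lemma sylvester_spectral_variation n (H K E M : 'M[C]_n) (sigma : R) k
    (I : pred 'I_n) :
  H^t* = H -> K^t* = K -> H *m M - M *m K = E ->
  0 < sigma -> (forall j, sigma <= singvals M 0 j) ->
  (0 < k)%N -> #|I| = k ->
  exists U V : 'M[C]_n,
    [/\ isometry_rank_le k U, isometry_rank_le k V &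
        sigma * \sum_(i | I i) `|eigvals H 0 i - eigvals K 0 i|
          <= Re (\tr (U^t* *m E *m V))].
Proof.
move=> Hherm Kherm HMK sigma_gt0 le_s k_gt0 card_I.
have [W [S [WW Sherm MWS le_S]]] := polar_decomposition sigma_gt0 le_s.
have [QH Hd] := eigvals_basis Hherm; have [QK Kd] := eigvals_basis Kherm.
have WWV : W *m W^t* = 1%:M by apply: mulmx1C.
pose H' := W^t* *m H *m W.
(* H' is unitarily similar to H, hence has the same eigenvalues. *)
have H'd : eigenbasis H' (W^t* *m QH) (eigvals H).
  split; first by rewrite adjmxM trmxCK mulmxA -(mulmxA _ W) WWV mulmx1 Hd.1.
  by rewrite /H' {1}Hd.2 adjmxM trmxCK !mulmxA.
have [D DE] : exists D, D = H' - K by exists (H' - K).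
have Dherm : D^t* = D by rewrite DE adjmxB (eigenbasis_adj H'd) Kherm.
have [Z Dd] := eigvals_basis Dherm.
set d := eigvals D in Dd.
have [q qE] := decreasing_perm (absv d).
have absE j : absv d 0 j = `|d 0 j| by rewrite mxE.
have le_kn : (k <= n)%N by rewrite -card_I -[n in leqRHS]card_ord max_card.
have [|||t t_ge0 sum_t] := @threshold_sum R n k (fun j => `|d 0 j|) q.
- by rewrite k_gt0.
- by move=> i; apply: normr_ge0.
- by move=> i j le_ij; rewrite -!absE -!qE decreasing_nonincreasing.
(* q lists the eigenvalues of D by decreasing modulus, and top is the indicator
   of the first k of them. *)
pose top (j : 'I_n) : R := ((q^-1)%g j < k)%N%:R.
pose e := \row_j (Num.sg (d 0 j) * top j).
have top2 j : top j * top j = top j.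
  by rewrite /top -natrM mulnb andbb.
have sum_top : \sum_j top j = k%:R.
  rewrite (reindex_inj (@perm_inj _ q)) /top.
  rewrite -[in RHS](sum_ord_lt le_kn) natr_sum.
  rewrite [RHS]big_mkcond; apply: eq_bigr => i _; rewrite permK.
  by case: (i < k)%N.
exists (W *m (Z *m rdiag e)), (Z *m rdiag (\row_j top j)); split.
- apply: isometry_rank_leM WW _; apply: isometry_rank_le_diag Dd.1 _ _.
    move=> j; rewrite mxE exprMn !exprS expr0 !mulr1 !top2.
    by case: sgrP => _; ring.
  rewrite -sum_top; apply: ler_sum => j _; rewrite mxE exprMn [top j ^+ 2]expr2.
  rewrite top2 ler_piMl ?ler0n //.
  by case: sgrP; rewrite ?expr0n ?expr1n ?sqrrN ?expr1n ?ler01.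
- apply: isometry_rank_le_diag Dd.1 _ _.
    by move=> j; rewrite mxE !exprS expr0 mulr1 !top2.
  by rewrite -sum_top; apply: ler_sum => j _; rewrite mxE expr2 top2.
pose F := Z^t* *m (W^t* *m E) *m Z.
have F_diag j : Re (F j j) = d 0 j * qform S Z j.
  have WE : W^t* *m E = D *m S + (K *m S - S *m K).
    rewrite -HMK MWS mulmxBr !mulmxA WW mul1mx -/H' DE mulmxBl.
    by rewrite addrA subrK.
  have -> : F = rdiag d *m (Z^t* *m S *m Z) + Z^t* *m (K *m S - S *m K) *m Z.
    have ZD : Z^t* *m D = rdiag d *m Z^t*.
      rewrite -(eigenbasis_diag Dd) -!mulmxA.
      by rewrite (eigenbasisQV Dd) mulmx1.
    by rewrite /F WE mulmxDr mulmxDl !mulmxA ZD.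
  rewrite mxE ReD rdiag_mulmx ReM_real mulmxBr mulmxBl.
  set T := Z^t* *m (K *m S) *m Z.
  have <- : T^t* = Z^t* *m (S *m K) *m Z.
    by rewrite !adjmxM trmxCK Sherm Kherm !mulmxA.
  by rewrite Re_skew_diag addr0 qformE.
have -> : Re (\tr ((W *m (Z *m rdiag e))^t* *m E
                  *m (Z *m rdiag (\row_j top j))))
    = \sum_j top j * `|d 0 j| * qform S Z j.
  have -> : (W *m (Z *m rdiag e))^t* *m E *m (Z *m rdiag (\row_j top j))
      = rdiag e *m F *m rdiag (\row_j top j).
    by rewrite !adjmxM adj_rdiag /F !mulmxA.
  rewrite /mxtrace Re_sum; apply: eq_bigr => j _.
  rewrite mulmx_rdiag rdiag_mulmx !ReM_real F_diag [e 0 j]mxE.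
  rewrite [(\row__ _) 0 j]mxE normrEsg.
  by rewrite -{3}[top j]top2; ring.
apply: (@le_trans _ _ (\sum_j top j * `|d 0 j| * sigma)).
  rewrite -mulr_suml [leRHS]mulrC ler_pM2l //.
  have H'E : H' = K + D by rewrite DE addrC subrK.
  apply: le_trans (mirsky I H'd Kd _ _ H'E Dd t_ge0) _;
    try exact: eigvals_nonincreasing.
  rewrite card_I sum_t [leRHS](reindex_inj (@perm_inj _ q)) [leLHS]big_mkcond.
  apply: ler_sum => i _; rewrite /top permK.
  by case: (i < k)%N; rewrite ?mul1r ?mul0r.
apply: ler_sum => j _; rewrite ler_wpM2l ?mulr_ge0 ?ler0n //.
apply: le_trans (le_S _ Z j); rewrite -Re_gram_diag Dd.1 mxE eqxx mulr1n.
by rewrite /= mulr1.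
Qed.

End Core.

(** * Orthogonal projectors, invariant subspaces and principal angles *)

Section Subspaces.
Variable R : realType.
Local Notation C := R[i].
Local Notation Re := complex.Re.

Lemma col_mulmx m n p (A : 'M[C]_(m, n)) (B : 'M[C]_(n, p)) j :
  col j (A *m B) = A *m col j B.
Proof. by rewrite !colE mulmxA. Qed.

Lemma eq_colP m n (A B : 'M[C]_(m, n)) : (forall j, col j A = col j B) -> A = B.
Proof.
move=> AB; apply/matrixP => i j.
by have /colP/(_ i) := AB j; rewrite [LHS]mxE [RHS]mxE.
Qed.

(** The range of 1 - P is orthogonal to that of P, that is (1 - P) P^* = 0, so
P^* = P P^* is self-adjoint. *)
Lemma orthoproj_adj n (U : {vspace 'cV[C]_n}) : (orthoproj U)^t* = orthoproj U.
Proof.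
rewrite /orthoproj; set B := \matrix_i _; set P := proj_ortho B.
have sPB : (P <= B)%MS by rewrite -[P]mul1mx proj_ortho_sub.
have sQB := proj_ortho_compl_sub B (1%:M : 'M[C]_n).
rewrite mul1mx -/P in sQB; clearbody P.
have PQ : (1%:M - P) *m P^t* = 0.
  apply/orthomx1P; apply: submx_trans sQB _.
  by rewrite submx_ortho.
have PE : P^t* = P *m P^t*.
  by apply/eqP; rewrite -subr_eq0 -{1}[P^t*]mul1mx -mulmxBl PQ.
have PP : P^t* = P by rewrite -[RHS]trmxCK PE adjmxM trmxCK.
by rewrite -[in RHS]PP map_trmx trmxK; apply/matrixP => i j; rewrite !mxE.
Qed.

Lemma orthoproj_id n (U : {vspace 'cV[C]_n}) v :
  v \in U -> orthoproj U *m v = v.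
Proof.
move=> vU; rewrite /orthoproj; set B := \matrix_i _.
suff sB : (v^T <= B)%MS.
  by apply: trmx_inj; rewrite trmx_mul trmxK proj_ortho_id.
rewrite (coord_vbasis vU) linear_sum /=; apply: summx_sub => i _.
rewrite linearZ /= scalemx_sub // -[_^T](rowK (fun i => ((vbasis U)`_i)^T)).
exact: row_sub.
Qed.

Section OrthonormalBasis.
Variables (n p : nat) (X : 'M[C]_(n, p)) (U : {vspace 'cV[C]_n}).
Hypothesis XU : orthonormal_basis X U.

Lemma basis_col_mem j : col j X \in U.
Proof.
have [/andP[/eqP <- _] _] := XU.
by apply: memv_span; apply/mapP; exists j; rewrite ?mem_enum.
Qed.

Lemma orthoproj_basis : orthoproj U *m X = X.
Proof.
apply: eq_colP => j; rewrite col_mulmx.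
exact: orthoproj_id (basis_col_mem j).
Qed.

Lemma basis_gram_id v : v \in U -> X *m X^t* *m v = v.
Proof.
have [/andP[/eqP UE _] XX] := XU.
rewrite -UE => /coord_span -> ; rewrite mulmx_sumr; apply: eq_bigr => i _.
rewrite -scalemxAr; congr (_ *: _).
have /mapP[j _ ->] : [seq col j X | j <- enum 'I_p]`_i
    \in [seq col j X | j <- enum 'I_p].
  by rewrite mem_nth // size_map -cardE ltn_ord.
by rewrite -col_mulmx -mulmxA XX mulmx1.
Qed.

(** The columns of A X lie in U, where X X^* acts as the identity. *)
Lemma residual_invariant (A : 'M[C]_n) :
  invariant_subspace A U -> residual A X = 0.
Proof.
move=> AU; apply/eqP; rewrite subr_eq0; apply/eqP/eq_colP => j.
rewrite /rayleigh -(mulmxA _ A) mulmxA !col_mulmx.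
by rewrite basis_gram_id ?AU ?basis_col_mem.
Qed.

End OrthonormalBasis.

(** Singular values of X^* Y lie in [0, 1], so each is the cosine of its [acos];
the cosine decreases on [0, pi]. *)
Lemma cos_theta_max n p (X Y : 'M[C]_(n, p)) :
  X^t* *m X = 1%:M -> Y^t* *m Y = 1%:M ->
  (forall i, principal_angles X Y 0 i < pi / 2) ->
  0 < cos (theta_max X Y) /\
  forall j, cos (theta_max X Y) <= singvals (X^t* *m Y) 0 j.
Proof.
move=> XX YY lt_pi.
have pi2_gt0 : 0 < (pi : R) / 2 by rewrite divr_gt0 ?pi_gt0.
have s01 j : 0 <= singvals (X^t* *m Y) 0 j <= 1.
  rewrite singvals_ge0 /= -(@expr_le1 _ 2) ?singvals_ge0 //.
  have [Q MQ] := singvals_basis (X^t* *m Y).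
  set s := singvals _ in MQ *.
  have -> : s 0 j ^+ 2 = \sum_i sqmod ((X^t* *m (Y *m Q)) i j).
    have /matrixP/(_ j j)/(congr1 (@complex.Re R)) := eigenbasis_diag MQ.
    rewrite Re_rdiag [(\row__ _) 0 j]mxE => <-.
    by rewrite -Re_gram_diag !adjmxM !mulmxA.
  apply: le_trans (partial_isometry_le _ _ _) _.
    by rewrite -mulmxA XX mulmx1.
  rewrite -Re_gram_diag adjmxM -mulmxA (mulmxA _ Y) YY mul1mx MQ.1.
  by rewrite mxE eqxx.
set th := theta_max X Y.
have le_th i : principal_angles X Y 0 i <= th by exact: le_bigmax.
have th_ge0 : 0 <= th by exact: bigmax_ge_id.
have th_lt : th < pi / 2 by apply/bigmax_ltP; split.
split=> [|j].
  by rewrite cos_gt0_pihalf // th_lt (lt_le_trans _ th_ge0) // oppr_lt0.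
have [q qE] := decreasing_perm (map_mx (@acos R) (singvals (X^t* *m Y))).
have := le_th ((q^-1)%g j); rewrite /principal_angles qE permKV mxE.
set s := singvals _ 0 j => le_acos.
have /andP[s_ge0 s_le1] : 0 <= s <= 1 by exact: s01.
have sI : -1 <= s <= 1 by rewrite s_le1 (le_trans _ s_ge0) // lerN10.
have [/andP[a0 api] cosa] := acos_def sI.
have thI : th \in `[0, pi].
  rewrite in_itv /= th_ge0 (le_trans (ltW th_lt)) // ler_pdivrMr ?ltr0n //.
  by rewrite ler_peMr ?pi_ge0 // ler1n.
by rewrite -cosa leNgt ltr_cos ?in_itv /= ?a0 ?api // -leNgt.
Qed.

End Subspaces.

(** * Variation of Ritz values *)

Section Ritz.
Variable R : realType.
Local Notation C := R[i].
Local Notation Re := complex.Re.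

Lemma Re_tr_adj n (T : 'M[C]_n) : Re (\tr (T^t* )) = Re (\tr T).
Proof.
by rewrite /mxtrace !Re_sum; apply: eq_bigr => i _; rewrite !mxE Re_adj.
Qed.

Lemma singvals0 m n j : singvals (0 : 'M[C]_(m, n)) 0 j = 0.
Proof.
have [Q MQ] := singvals_basis (0 : 'M[C]_(m, n)).
have /matrixP/(_ j j)/(congr1 (@complex.Re R)) := eigenbasis_diag MQ.
rewrite Re_rdiag !mulmx0 mul0mx mxE [RHS]mxE => /esym/eqP.
by rewrite sqrf_eq0 => /eqP.
Qed.

(** The k largest entries form one of the index sets of cardinality k. *)
Lemma weak_majorize_absvP m (c : R) (x s : 'rV[R]_m) :
  0 < c -> nonincreasing s ->
  (forall k (I : pred 'I_m), (0 < k <= m)%N -> #|I| = k ->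
     c * \sum_(i | I i) `|x 0 i| <= \sum_(i < m | (i < k)%N) s 0 i) ->
  absv x <w c^-1 *: s.
Proof.
move=> c_gt0 s_dec le_xs k k_bounds.
rewrite (@decreasing_id _ _ (c^-1 *: s)); last first.
  by move=> i j le_ij; rewrite [leLHS]mxE [leRHS]mxE ler_pM2l ?invr_gt0 ?s_dec.
have -> : \sum_(i < m | (i < k)%N) (c^-1 *: s) 0 i
    = c^-1 * \sum_(i < m | (i < k)%N) s 0 i.
  by rewrite mulr_sumr; apply: eq_bigr => i _; rewrite mxE.
rewrite ler_pdivlMl //; have [q qE] := decreasing_perm (absv x).
apply: le_trans (le_xs k [pred j | ((q^-1)%g j < k)%N] k_bounds _).
  rewrite ler_pM2l // [leRHS](reindex_inj (@perm_inj _ q)) /=.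
  rewrite le_eqVlt; apply/orP; left; apply/eqP.
  by apply: eq_big => [i|i _]; rewrite ?permK // qE mxE.
rewrite -sum1_card (reindex_inj (@perm_inj _ q)) /=.
rewrite -[RHS](@sum_ord_lt m k); last by case/andP: k_bounds.
by apply: eq_bigl => i; rewrite inE permK.
Qed.

Section Bounds.
Variables (n p : nat) (A : 'M[C]_n) (calX calY : {vspace 'cV[C]_n}).
Variables (X Y : 'M[C]_(n, p)).
Hypotheses (Aherm : A^t* = A) (XB : orthonormal_basis X calX)
  (YB : orthonormal_basis Y calY)
  (angles : forall i, principal_angles X Y 0 i < pi / 2).

(** The projectors can be inserted since P_X X = X and P_Y Y = Y; the term of
R_X is an adjoint, and its sign is absorbed by [- U]. *)
Lemma ritz_variation k (I : pred 'I_p) : (0 < k)%N -> #|I| = k ->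
  cos (theta_max X Y) *
    \sum_(i | I i) `|eigvals (rayleigh A X) 0 i - eigvals (rayleigh A Y) 0 i|
  <= \sum_(i < p | (i < k)%N)
       (singvals (orthoproj calY *m residual A X) 0 i
        + singvals (orthoproj calX *m residual A Y) 0 i).
Proof.
move=> k_gt0 card_I; have [XX YY] := (XB.2, YB.2).
have [cos_gt0 le_cos] := cos_theta_max XX YY angles.
have rherm (Z : 'M[C]_(n, p)) : (rayleigh A Z)^t* = rayleigh A Z.
  by rewrite !adjmxM trmxCK Aherm mulmxA.
have [|U [V [Uk Vk le_tr]]] := @sylvester_spectral_variation R p
  (rayleigh A X) (rayleigh A Y)
  (X^t* *m residual A Y - (Y^t* *m residual A X)^t* ) (X^t* *m Y)
  (cos (theta_max X Y)) k I (rherm X) (rherm Y) _ cos_gt0 le_cos k_gt0 card_I.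
  rewrite /residual adjmxM trmxCK adjmxB (adjmxM A X).
  rewrite (adjmxM X (rayleigh A X)) (rherm X) Aherm.
  rewrite mulmxBr mulmxBl !mulmxA.
  have cancel (V : zmodType) (a b c : V) : c - b = a - b - (a - c).
    by rewrite opprB [RHS]addrC addrA subrK.
  exact: cancel.
apply: le_trans le_tr _; rewrite mulmxBr mulmxBl linearB ReB big_split addrC /=.
have le_kp : (k <= p)%N by rewrite -card_I -[p in leqRHS]card_ord max_card.
have PXX : (orthoproj calX *m X)^t* = X^t* by rewrite (orthoproj_basis XB).
have PYY : (orthoproj calY *m Y)^t* = Y^t* by rewrite (orthoproj_basis YB).
rewrite lerD //.
  have -> : - Re (\tr (U^t* *m (Y^t* *m residual A X)^t* *m V))
     = Re (\tr ((Y *m V)^t* *m (orthoproj calY *m residual A X) *m (- U))).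
    rewrite -Re_tr_adj mulmxN linearN raddfN /=; congr (- Re (\tr _)).
    by rewrite -PYY !adjmxM !trmxCK (orthoproj_adj calY) !mulmxA.
  apply: ky_fan => //; first exact: isometry_rank_leM.
  exact: isometry_rank_leN.
have -> : U^t* *m (X^t* *m residual A Y) *m V
   = (X *m U)^t* *m (orthoproj calX *m residual A Y) *m V.
  by rewrite -PXX !adjmxM (orthoproj_adj calX) !mulmxA.
by apply: ky_fan => //; exact: isometry_rank_leM.
Qed.

End Bounds.
End Ritz.

Theorem theorem4p1 (R : realType) (n p : nat) (A : 'M[R[i]]_n)
    (calX calY : {vspace 'cV[R[i]]_n}) (X Y : 'M[R[i]]_(n, p)) :
  A \is hermsymmx ->
  orthonormal_basis X calX ->
  orthonormal_basis Y calY ->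
  \dim calX = p ->
  \dim calY = p ->
  (forall i, principal_angles X Y 0 i < pi / 2) ->
  (absv (eigvals (rayleigh A X) - eigvals (rayleigh A Y))
     <w (cos (theta_max X Y))^-1 *:
          (singvals (orthoproj calY *m residual A X)
           + singvals (orthoproj calX *m residual A Y)))
  /\
  (invariant_subspace A calX ->
   absv (eigvals (rayleigh A X) - eigvals (rayleigh A Y))
     <w (cos (theta_max X Y))^-1 *:
          singvals (orthoproj calX *m residual A Y)).
Proof.
move=> /is_hermitianmxP; rewrite expr0 scale1r => /esym Aherm XB YB _ _ angles.
have [cos_gt0 _] := cos_theta_max XB.2 YB.2 angles.
have main : absv (eigvals (rayleigh A X) - eigvals (rayleigh A Y))
     <w (cos (theta_max X Y))^-1 *:
          (singvals (orthoproj calY *m residual A X)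
           + singvals (orthoproj calX *m residual A Y)).
  apply: weak_majorize_absvP => // [i j le_ij|k I /andP[k_gt0 _] card_I].
    by rewrite [leLHS]mxE [leRHS]mxE lerD ?singvals_nonincreasing.
  have := ritz_variation Aherm XB YB angles k_gt0 card_I.
  congr (_ * _ <= _); apply: eq_bigr => i _; last by rewrite [RHS]mxE.
  by rewrite [in RHS]mxE [X in _ = `|_ + X|]mxE.
split=> // invX; rewrite -[singvals _]add0r.
suff <- : singvals (orthoproj calY *m residual A X) = 0 by [].
rewrite (residual_invariant XB invX) mulmx0.
by apply/rowP => j; rewrite singvals0 mxE.
Qed.
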